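(* There is an absolute constant $C>0$ such that the following holds. Let $P:\mathbb{R}^n\to\mathbb{R}$ be a polynomial of degree $d$ that is either multilinear or corresponds to an ellipsoid, and let $f=\mathrm{sign}(P)$. Then for all $0<\delta<1$, $$\mathbb{GNS}_\delta(f)\le 2^{Cd}\,\delta^{1/(2d+1)}.$$
   Context: For $f:\mathbb{R}^n\to\{-1,1\}$ and $\delta\in(0,1)$, the Gaussian noise sensitivity is $\mathbb{GNS}_\delta(f)=\Pr[f(X)\neq f(Z)]$, where $X,Y$ are independent standard Gaussian vectors in $\mathbb{R}^n$ (distribution $\mathcal{N}(0,1)^n$) and $Z=(1-\delta)X+\sqrt{2\delta-\delta^2}\,Y$. A polynomial is multilinear if every monomial is a product of distinct variables. A polynomial ''corresponds to an ellipsoid'' if it is of the form $P(x)=1-(x-c)^{T}A(x-c)$ with $A$ positive definite and $c\in\mathbb{R}^n$, so that $\mathrm{sign}(P)$ is the $\pm1$ indicator of an ellipsoid (degree $d=2$). The sign function maps reals to $\{1,-1\}$ with some fixed convention at $0$. *)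

(* Defs.v *)
From HB Require Import structures.
From mathcomp Require Import all_boot all_order all_algebra.
(* The notations of [mpoly] and mathcomp-analysis clash when [mpoly] is imported
   second. *)
From mathcomp Require Import mpoly.
From mathcomp Require Import all_classical all_reals all_analysis.

Set Implicit Arguments.
Unset Strict Implicit.
Unset Printing Implicit Defensive.

Import Order.TTheory GRing.Theory Num.Theory.
Import numFieldNormedType.Exports.

Local Open Scope classical_set_scope.
Local Open Scope ring_scope.

Section StandardGaussian.
Variable R : realType.

Definition of_measurableTypeR : measurableTypeR R -> R := idfun.

Lemma measurable_of_measurableTypeR :
  measurable_fun [set: measurableTypeR R] of_measurableTypeR.
Proof. by move=> _ A mA; rewrite setTI. Qed.

HB.instance Definition _ :=
  isMeasurableFun.Build _ _ _ _ of_measurableTypeR measurable_of_measurableTypeR.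

(* N(0,1). The library puts [normal_prob] on [measurableTypeR R], whose
   sigma-algebra has the same sets as the one of [R] but a different display;
   hence the transport along the identity. *)
Definition std_normal : probability R R :=
  distribution (normal_prob (0 : R) 1) of_measurableTypeR.

Definition tuple_cons n (xt : R * n.-tuple R) : n.+1.-tuple R :=
  [tuple of xt.1 :: xt.2].

Lemma measurable_tuple_cons n :
  measurable_fun [set: R * n.-tuple R] (@tuple_cons n).
Proof. exact: measurable_cons. Qed.

HB.instance Definition _ n :=
  isMeasurableFun.Build _ _ _ _ (@tuple_cons n) (@measurable_tuple_cons n).

(* N(0,1)^n on the product sigma-algebra of R^n: the n-fold product of
   [std_normal], R^(n+1) being identified with R * R^n. *)
Fixpoint std_gaussian (n : nat) : probability (n.-tuple R) R :=
  match n with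
  | 0 => \d_([tuple] : 0.-tuple R)
  | m.+1 => distribution (std_normal \x std_gaussian m)%E (@tuple_cons m)
  end.

(* Under [std_gaussian n] the coordinates are independent and N(0,1). *)
Lemma std_gaussian_box n (A : 'I_n -> set R) :
  (forall i, measurable (A i)) ->
  std_gaussian n [set x | forall i, A i (tnth x i)] =
  (\prod_(i < n) normal_prob (0 : R) 1 (A i))%E.
Proof.
elim: n A => [|n IHn] A mA.
  rewrite big_ord0 /= diracE mem_set//= => -[]//.
rewrite big_ord_recl /= /distribution /pushforward.
rewrite (_ : _ @^-1` _ = A ord0 `*`
    [set x : n.-tuple R | forall i, A (lift ord0 i) (tnth x i)]); last first.
  apply/seteqP; split=> [[x t] /= H|[x t] /= [H0 H] i].
    by split=> [|i]; [exact: (H ord0)|have := H (lift ord0 i); rewrite tnthS].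
  by have [j ->|->//] := unliftP ord0 i; rewrite tnthS.
rewrite (product_measure1E std_normal (std_gaussian n))//=.
  by rewrite (IHn (fun i => A (lift ord0 i))).
rewrite (_ : mkset _ = \bigcap_(i in [set: 'I_n])
    ((@tnth n R)^~ i @^-1` A (lift ord0 i))); last first.
  by apply/seteqP; split=> x /= H i; [move=> _|]; exact: H.
apply: fin_bigcap_measurable => // i _.
by rewrite -[X in measurable X]setTI; exact: measurable_tnth.
Qed.

End StandardGaussian.

Section NoiseSensitivity.
Variables (R : realType) (n : nat).

Definition noisy (delta : R) (x y : n.-tuple R) : n.-tuple R :=
  [tuple (1 - delta) * tnth x i
         + Num.sqrt (2 * delta - delta ^+ 2) * tnth y i | i < n].

(* X and Y are the two coordinates of R^n * R^n under N(0,1)^n \x N(0,1)^n. *)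
Definition GNS (delta : R) (f : n.-tuple R -> R) : \bar R :=
  (std_gaussian R n \x std_gaussian R n)%E
    [set xy | f xy.1 <> f (noisy delta xy.1 xy.2)].

End NoiseSensitivity.

(* The +-1 valued sign; [b] is the convention at 0: the value there is 1 if
   [b = false] and -1 if [b = true]. *)
Definition sign (R : realType) (b : bool) (x : R) : R :=
  if x == 0 then (-1) ^+ b else Num.sg x.

Section Polynomials.
Variables (R : realType) (n : nat).
Implicit Type P : {mpoly R[n]}.

Definition peval P (x : n.-tuple R) : R := P.@[tnth x].

(* [msize P] is 1 + the total degree of P, and 0 for P = 0; so this is the
   total degree, with value 0 at P = 0. *)
Definition pdegree P : nat := (msize P).-1.

Definition multilinear P : Prop :=
  forall m, m \in msupp P -> forall i : 'I_n, (m i <= 1)%N.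

Definition positive_definite (A : 'M[R]_n) : Prop :=
  A^T = A /\ forall v : 'cV[R]_n, v != 0 -> 0 < (v^T *m A *m v) 0 0.

Definition ellipsoidal P : Prop :=
  exists (A : 'M[R]_n) (c : 'cV[R]_n), positive_definite A /\
  forall x : n.-tuple R, let v := (\col_i tnth x i) - c in
  peval P x = 1 - (v^T *m A *m v) 0 0.

End Polynomials.

(* Main.v *)
Require Import Defs.
From HB Require Import structures.
From mathcomp Require Import all_boot all_order all_algebra.
From mathcomp Require Import mpoly ring lra zify.
From mathcomp Require Import all_classical all_reals all_analysis measurable_realfun.
Set Implicit Arguments.
Unset Strict Implicit.
Unset Printing Implicit Defensive.
Import Order.TTheory GRing.Theory Num.Theory.
Import numFieldNormedType.Exports.

Local Open Scope classical_set_scope.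
Local Open Scope ring_scope.

(** Kane's rotation argument. Write 1 - delta = cos t and
    sqrt (2 delta - delta^2) = sin t, and let X_k = cos (k t) X + sin (k t) Y.
    Since the law of (X, Y) is rotation invariant, the pair (X_k, X_(k+1)) has the
    law of (X, Z), so f (X_k) <> f (X_(k+1)) with probability GNS_delta(f) for
    every k. For fixed X and Y, in terms of the half-angle tangent u, the map
    phi |-> P (cos phi X + sin phi Y) is (1 + u^2)^-d times a polynomial in u of
    degree at most 2d. Unless it vanishes identically, in which case the sign is
    constant, it therefore has a zero in at most 2d of the m disjoint intervals
    [2 j t, (2 j + 1) t], j < m. Taking expectations,
    m GNS_delta(f) <= 2d, and m can be taken of order delta^(-1/2). This gives the
    stronger bound GNS_delta(f) <= 8 d sqrt delta. *)

(** * Rotation invariance of the Gaussian measure *)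

Section Density.
Local Open Scope ereal_scope.
Context d (T : measurableType d) (R : realType).
Variables (mu nu : {measure set T -> \bar R}) (g : T -> R).
Hypothesis mg : measurable_fun [set: T] g.
Hypothesis g0 : forall x, (0 <= g x)%R.
Hypothesis nuE : forall A, measurable A -> nu A = \int[mu]_(x in A) (g x)%:E.

Import HBNNSimple.

(** Turns integrals against the normal law into Lebesgue integrals. Monotone convergence along
    simple functions reduces it to indicators, where it is [nuE]. *)
Lemma ge0_integral_density (f : T -> \bar R) :
  measurable_fun [set: T] f -> (forall x, 0 <= f x) ->
  \int[nu]_x f x = \int[mu]_x (f x * (g x)%:E).
Proof.
move=> mf f0.
pose h := nnsfun_approx measurableT mf.
have hf x : f x = limn (fun n => (h n x)%:E).
  by apply/esym/cvg_lim => //; exact: cvg_nnsfun_approx.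
have hmono x : {homo (fun n => (h n x)%:E) : m n / (m <= n)%N >-> m <= n}.
  by move=> m n mn; rewrite lee_fin; exact/lefP/nd_nnsfun_approx.
have mh n : measurable_fun [set: T] (fun x => (h n x)%:E).
  exact/measurable_EFinP.
transitivity (limn (fun n => \int[nu]_x (h n x)%:E)).
  rewrite -monotone_convergence//.
  - by apply: eq_integral => x _.
  - by move=> n x _; rewrite lee_fin.
transitivity (limn (fun n => \int[mu]_x ((h n x)%:E * (g x)%:E))); last first.
  rewrite -monotone_convergence//.
  - apply: eq_integral => x _; rewrite hf; apply/cvg_lim => //.
    apply: cvgeZr => //.
    by apply: ereal_nondecreasing_is_cvgn => m n; exact: hmono.
  - move=> n; apply: emeasurable_funM => //.
    exact/measurable_EFinP.
  - by move=> n x _; rewrite mule_ge0// lee_fin.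
  - by move=> x _ m n mn; rewrite lee_wpmul2r ?lee_fin//;
    have := hmono x _ _ mn; rewrite lee_fin.
congr (limn _); apply/funext => n.
have hE x : (h n x)%:E =
    \sum_(k \in range (h n)) (k * \1_(h n @^-1` [set k]) x)%:E.
  by rewrite fsumEFin// -fimfunE.
under eq_integral do rewrite hE.
rewrite ge0_integral_fsum//; last 2 first.
- by move=> y; exact/measurable_EFinP/measurable_funM.
- by move=> y x _; rewrite EFinM nnfun_muleindic_ge0.
under [RHS]eq_integral => x _.
  rewrite hE ge0_mule_fsuml; last by move=> k; rewrite EFinM nnfun_muleindic_ge0.
  over.
rewrite ge0_integral_fsum//; last 2 first.
- move=> y; apply: emeasurable_funM; first exact/measurable_EFinP/measurable_funM.
  exact/measurable_EFinP.
- by move=> y x _; rewrite mule_ge0// ?lee_fin//;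
    have := nnfun_muleindic_ge0 (h n) y x; rewrite lee_fin.
apply: eq_fsbigr => r; rewrite inE => -[x0 _ <-{r}].
set A := h n @^-1` _.
have mA : measurable A by exact: measurable_sfunP.
under eq_integral do rewrite EFinM.
rewrite ge0_integralZl//; [|exact/measurable_EFinP|by rewrite lee_fin].
rewrite integral_indic// setIT nuE//.
rewrite -ge0_integralZl//; last 3 first.
- exact/measurable_EFinP/measurable_funTS.
- by move=> *; rewrite lee_fin.
- by rewrite lee_fin.
rewrite integral_mkcond; apply: eq_integral => x _.
rewrite patchE indicE; case: ifP => _; first by rewrite mulr1.
by rewrite mulr0 mul0e.
Qed.

End Density.

(** * Translation invariance of Lebesgue measure on the line *)

Section Translation.
Variables (R : realType) (c : R).

Definition translation (x : measurableTypeR R) : measurableTypeR R := (x : R) + c.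

Lemma measurable_translation : measurable_fun setT translation.
Proof. exact: (@measurable_funD _ _ R setT id (cst c)). Qed.

HB.instance Definition _ :=
  isMeasurableFun.Build _ _ _ _ translation measurable_translation.

(** Lebesgue measure is determined by its values on the intervals ]a, b], and a translation
    preserves their length. *)
Lemma lebesgue_measure_translation (A : set (measurableTypeR R)) : measurable A ->
  pushforward lebesgue_measure translation A = lebesgue_measure A.
Proof.
move=> mA; apply/esym/lebesgue_measure_unique => //= _ [[a b]] _ <-.
rewrite /pushforward (_ : _ @^-1` _ = `]a - c, b - c]%classic); last first.
  by apply/seteqP; split=> x /=; rewrite /translation !in_itv/= ltrBlDr lerBrDr.
rewrite !lebesgue_measure_itv/= !lte_fin ltrD2r.
by case: ifP => // _; rewrite -!EFinD; congr EFin; ring.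
Qed.

Lemma ge0_integral_translation (f : measurableTypeR R -> \bar R) :
  measurable_fun setT f -> (forall r, 0 <= f r)%E ->
  (\int[lebesgue_measure]_x f (translation x) = \int[lebesgue_measure]_x f x)%E.
Proof.
move=> mf f0.
transitivity (\int[pushforward lebesgue_measure translation]_x f x)%E.
  by rewrite ge0_integral_pushforward.
by apply: eq_measure_integral => //= A mA AS; exact: lebesgue_measure_translation.
Qed.

End Translation.

(** * Rotations of the plane *)

Section GaussianRotation.
Variable R : realType.
Local Notation T := (measurableTypeR R).
Local Notation lambda := (@lebesgue_measure R).

Definition shear1 (p : R) (z : T * T) : T * T := ((z.1 : R) + p * (z.2 : R), z.2).
Definition shear2 (q : R) (z : T * T) : T * T := (z.1, (z.2 : R) + q * (z.1 : R)).

Lemma measurable_shear1 p : measurable_fun setT (shear1 p).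
Proof.
apply: measurable_fun_pair; last exact: measurable_snd.
apply: (@measurable_funD _ _ R); first exact: measurable_fst.
by apply: (@measurable_funM _ _ R) => //; exact: measurable_snd.
Qed.

Lemma measurable_shear2 q : measurable_fun setT (shear2 q).
Proof.
apply: measurable_fun_pair; first exact: measurable_fst.
apply: (@measurable_funD _ _ R); first exact: measurable_snd.
by apply: (@measurable_funM _ _ R) => //; exact: measurable_fst.
Qed.

Local Open Scope ereal_scope.

(** Once the two integrals are exchanged, the shear is, for each fixed y, a translation of x by
    [p * y]. *)
Lemma integral_shear1 p (F : T * T -> \bar R) :
  measurable_fun setT F -> (forall z, 0 <= F z) ->
  \int[lambda]_x \int[lambda]_y F (shear1 p (x, y)) =
  \int[lambda]_x \int[lambda]_y F (x, y).
Proof.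
move=> mF F0.
have mFs : measurable_fun setT (F \o shear1 p).
  exact: (measurableT_comp mF (measurable_shear1 p)).
rewrite (fubini_tonelli _ mFs (fun=> F0 _)) (fubini_tonelli _ mF F0).
apply: eq_integral => y _.
apply: (@ge0_integral_translation R (p * y) (fun x => F (x, y))) => //.
exact: measurableT_comp.
Qed.

Lemma integral_shear2 q (F : T * T -> \bar R) :
  measurable_fun setT F -> (forall z, 0 <= F z) ->
  \int[lambda]_x \int[lambda]_y F (shear2 q (x, y)) =
  \int[lambda]_x \int[lambda]_y F (x, y).
Proof.
move=> mF F0; apply: eq_integral => x _.
apply: (@ge0_integral_translation R (q * x) (fun y => F (x, y))) => //.
exact: measurableT_comp.
Qed.

(** With a = cos t and b = sin t, this is the rotation by the angle -t. *)
Definition plane_rotation (a b : R) (z : R * R) : R * R :=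
  (a * z.1 + b * z.2, - b * z.1 + a * z.2)%R.

(* Lebesgue measure on the plane is rotation invariant because a rotation is a
   composition of three shears and each shear is a translation on every line of
   one of the two axis directions. *)
Lemma plane_rotation_shears (a b : R) (z : T * T) : (a ^+ 2 + b ^+ 2 = 1 -> b != 0 ->
  plane_rotation a b z =
  shear1 ((1 - a) / b) (shear2 (- b) (shear1 ((1 - a) / b) z)))%R.
Proof.
(* Here [p] stands for (1 - a) / b, the tangent of the half-angle. Its two relations to a and b turn
   the claim into polynomial identities without division. *)
have main (p x y : R) : (p * b = 1 - a -> p * a = b - p ->
    a * x + b * y = x + p * y + p * (y + - b * (x + p * y)) /\
    - b * x + a * y = y + - b * (x + p * y))%R.
  move=> e e'; split; apply/eqP; rewrite -subr_eq0; apply/eqP.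
    transitivity ((p * b - (1 - a)) * (x + p * y) - (p * a - (b - p)) * y)%R; first ring.
    by rewrite e e'; ring.
  transitivity ((p * b - (1 - a)) * y)%R; first ring.
  by rewrite e; ring.
move=> ab b0; case: z => x y; rewrite /plane_rotation /shear1 /shear2 /=.
have e : ((1 - a) / b * b = 1 - a)%R by rewrite divfK.
have e2 : ((1 - a) / b * (1 + a) = b)%R.
  by apply: (mulIf b0); rewrite mulrAC e -expr2 -[RHS](addKr (a ^+ 2)%R) ab; ring.
have e3 : ((1 - a) / b * a = b - (1 - a) / b)%R.
  by apply/esym/eqP; rewrite subr_eq; apply/eqP; rewrite -[LHS]e2; ring.
by have [H1 H2] := main _ x y e e3; congr pair.
Qed.

Lemma integral_lebesgue_rotation (a b : R) (F : T * T -> \bar R) :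
  (a ^+ 2 + b ^+ 2 = 1)%R -> (b != 0)%R ->
  measurable_fun setT F -> (forall z, 0 <= F z) ->
  \int[lambda]_x \int[lambda]_y F (plane_rotation a b (x, y)) =
  \int[lambda]_x \int[lambda]_y F (x, y).
Proof.
move=> ab b0 mF F0; set p := ((1 - a) / b)%R.
have m1 : measurable_fun setT (F \o shear1 p).
  exact: (measurableT_comp mF (measurable_shear1 p)).
have m2 : measurable_fun setT (F \o shear1 p \o shear2 (- b)%R).
  exact: (measurableT_comp m1 (measurable_shear2 (- b)%R)).
(* The three shears are inserted on the right-hand side, the outermost first. *)
rewrite -(integral_shear1 p mF F0).
rewrite -(integral_shear2 (- b) m1 (fun=> F0 _)).
rewrite -(integral_shear1 p m2 (fun=> F0 _)).
apply: eq_integral => x _; apply: eq_integral => y _.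
by rewrite plane_rotation_shears.
Qed.

Let g (x : R) : R := normal_pdf 0 1 x.

(** The joint density depends on x^2 + y^2 only, which a rotation preserves. *)
Lemma normal_pdf_rotation (a b x y : R) : (a ^+ 2 + b ^+ 2 = 1 ->
  normal_pdf 0 1 (a * x + b * y) * normal_pdf 0 1 (- b * x + a * y) =
  normal_pdf 0 1 x * normal_pdf 0 1 y)%R.
Proof.
move=> ab; rewrite !normal_pdfE ?oner_neq0//= /normal_fun.
rewrite mulrACA [RHS]mulrACA -!expRD.
congr (_ * expR _)%R; rewrite -!mulrDl; congr (_ / _)%R.
rewrite !subr0 -!opprD; congr (- _)%R.
by rewrite -[RHS]mul1r -ab; ring.
Qed.

Let measurable_g : measurable_fun [set: T] (fun x => (g x)%:E).
Proof.
exact: (proj2 (@measurable_EFinP _ T R setT g) (measurable_normal_pdf 0 1)).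
Qed.

Lemma ge0_integral_std_normal (f : R -> \bar R) :
  measurable_fun setT f -> (forall x, 0 <= f x) ->
  \int[std_normal R]_x f x = \int[lambda]_x (f x * (g x)%:E).
Proof.
move=> mf f0.
rewrite /std_normal ge0_integral_distribution//.
apply: (ge0_integral_density (mu := lambda) (nu := normal_prob 0 1)) => //.
- exact: measurable_normal_pdf.
- by move=> x; exact: normal_pdf_ge0.
Qed.

Lemma ge0_integral_std_normal2 (F : R * R -> \bar R) :
  measurable_fun setT F -> (forall z, 0 <= F z) ->
  \int[std_normal R]_x \int[std_normal R]_y F (x, y) =
  \int[lambda]_x \int[lambda]_y (F (x, y) * (g x * g y)%:E).
Proof.
move=> mF F0.
rewrite ge0_integral_std_normal; last 2 first.
- exact: (measurable_fun_fubini_tonelli_F F).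
- by move=> x; exact: integral_ge0.
apply: eq_integral => x _.
have mFx : measurable_fun setT (fun y => F (x, y)) by exact: measurableT_comp.
rewrite ge0_integral_std_normal//.
rewrite muleC -ge0_integralZl//; last 3 first.
- apply: emeasurable_funM; first exact: mFx.
  exact: measurable_g.
- by move=> y _; rewrite mule_ge0// lee_fin normal_pdf_ge0.
- by rewrite lee_fin normal_pdf_ge0.
by apply: eq_integral => y _; rewrite muleCA EFinM.
Qed.

(** Both sides become Lebesgue integrals of [F] times the joint density. That density is rotation
    invariant, so Lebesgue invariance applies to the product. *)
Lemma integral_std_normal_rotation (a b : R) (F : R * R -> \bar R) :
  (a ^+ 2 + b ^+ 2 = 1)%R -> (b != 0)%R ->
  measurable_fun setT F -> (forall z, 0 <= F z) ->
  \int[std_normal R]_x \int[std_normal R]_y F (plane_rotation a b (x, y)) =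
  \int[std_normal R]_x \int[std_normal R]_y F (x, y).
Proof.
move=> ab b0 mF F0.
have mrot : measurable_fun setT (plane_rotation a b).
  apply: measurable_fun_pair; apply: measurable_funD; apply: measurable_funM => //;
    solve [exact: measurable_fst | exact: measurable_snd].
rewrite (ge0_integral_std_normal2 (measurableT_comp mF mrot) (fun=> F0 _)).
rewrite (ge0_integral_std_normal2 mF F0).
rewrite -(integral_lebesgue_rotation (F := fun z => F z * (g z.1 * g z.2)%:E) ab b0).
- apply: eq_integral => x _; apply: eq_integral => y _.
  by rewrite /g /= (normal_pdf_rotation x y ab).
- apply: emeasurable_funM.
    exact: mF.
  apply/measurable_EFinP; apply: measurable_funM.
    exact: (measurableT_comp (measurable_normal_pdf 0 1) measurable_fst).
  exact: (measurableT_comp (measurable_normal_pdf 0 1) measurable_snd).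
- by move=> z; rewrite mule_ge0// lee_fin mulr_ge0// normal_pdf_ge0.
Qed.

End GaussianRotation.

(** * Rotations of pairs of Gaussian vectors *)

Section GaussianRotationTuple.
Variable R : realType.

Definition tuple_comb n (a b : R) (x y : n.-tuple R) : n.-tuple R :=
  [tuple a * tnth x i + b * tnth y i | i < n].

(** The second component makes the map orthogonal when a^2 + b^2 = 1, so that it preserves the law
    of (X, Y) and can be iterated. *)
Definition rotation n (a b : R) (z : n.-tuple R * n.-tuple R) :=
  (tuple_comb a b z.1 z.2, tuple_comb (- b) a z.1 z.2).

Lemma tuple_comb_cons n (a b x y : R) (s t : n.-tuple R) :
  tuple_comb a b (tuple_cons (x, s)) (tuple_cons (y, t)) =
  tuple_cons (a * x + b * y, tuple_comb a b s t).
Proof.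
apply: eq_from_tnth => i; rewrite tnth_mktuple.
by have [j ->|->//] := unliftP ord0 i; rewrite !tnthS tnth_mktuple.
Qed.

Lemma measurable_tuple_comb n (a b : R) :
  measurable_fun setT (fun z : n.-tuple R * n.-tuple R => tuple_comb a b z.1 z.2).
Proof.
apply/measurable_fun_tnthP => i.
rewrite (_ : _ \o _ = fun z => a * tnth z.1 i + b * tnth z.2 i); last first.
  by apply/funext => z /=; rewrite tnth_mktuple.
apply: measurable_funD; apply: measurable_funM => //.
  exact: (measurableT_comp (measurable_tnth i) measurable_fst).
exact: (measurableT_comp (measurable_tnth i) measurable_snd).
Qed.

Lemma measurable_rotation n (a b : R) : measurable_fun setT (@rotation n a b).
Proof. by apply: measurable_fun_pair; exact: measurable_tuple_comb. Qed.

Local Open Scope ereal_scope.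

Lemma ge0_integral_std_gaussian_cons n (F : n.+1.-tuple R -> \bar R) :
  measurable_fun setT F -> (forall x, 0 <= F x) ->
  \int[std_gaussian R n.+1]_x F x =
  \int[std_normal R]_x \int[std_gaussian R n]_s F (tuple_cons (x, s)).
Proof.
move=> mF F0.
rewrite [LHS]ge0_integral_distribution//.
exact: (fubini_tonelli1 _ (measurableT_comp mF (@measurable_tuple_cons R n))
  (fun=> F0 _)).
Qed.

(** Splitting off the heads gives integrals in the order x, s, y, t; Tonelli then exchanges s and
    y. *)
Lemma ge0_integral_std_gaussian_cons2 n (F : n.+1.-tuple R * n.+1.-tuple R -> \bar R) :
  measurable_fun setT F -> (forall z, 0 <= F z) ->
  \int[std_gaussian R n.+1]_s \int[std_gaussian R n.+1]_t F (s, t) =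
  \int[std_normal R]_x \int[std_normal R]_y
    \int[std_gaussian R n]_s \int[std_gaussian R n]_t
      F (tuple_cons (x, s), tuple_cons (y, t)).
Proof.
move=> mF F0.
rewrite ge0_integral_std_gaussian_cons; last 2 first.
- exact: (measurable_fun_fubini_tonelli_F _ mF).
- by move=> x; exact: integral_ge0.
apply: eq_integral => x _.
have mH : measurable_fun setT (fun u : (n.-tuple R * R) * n.-tuple R =>
    F (tuple_cons (x, u.1.1), tuple_cons (u.1.2, u.2))).
  apply: (measurableT_comp mF); apply: measurable_fun_pair.
    apply: measurable_cons => //.
    exact: (measurableT_comp measurable_fst measurable_fst).
  apply: measurable_cons; last exact: measurable_snd.
  exact: (measurableT_comp measurable_snd measurable_fst).
have mG := measurable_fun_fubini_tonelli_F (m2 := std_gaussian R n) _ mH (fun=> F0 _).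
rewrite -(fubini_tonelli _ mG); last by move=> z; exact: integral_ge0.
apply: eq_integral => s _.
rewrite ge0_integral_std_gaussian_cons//.
exact: measurableT_comp.
Qed.

(** Induction on n: the rotation acts on each pair of coordinates (x_i, y_i) separately, so the
    heads are handled by the planar case. *)
Lemma integral_std_gaussian_rotation n (a b : R)
    (F : n.-tuple R * n.-tuple R -> \bar R) :
  (a ^+ 2 + b ^+ 2 = 1)%R -> (b != 0)%R ->
  measurable_fun setT F -> (forall z, 0 <= F z) ->
  \int[std_gaussian R n]_s \int[std_gaussian R n]_t F (rotation a b (s, t)) =
  \int[std_gaussian R n]_s \int[std_gaussian R n]_t F (s, t).
Proof.
move=> ab b0; elim: n F => [|n IHn] F mF F0.
  apply: eq_integral => s _; apply: eq_integral => t _.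
  by rewrite /rotation /= (tuple0 s) (tuple0 t) !(tuple0 (tuple_comb _ _ _ _)).
have mFr := measurableT_comp mF (measurable_rotation (n := n.+1) a b).
rewrite (ge0_integral_std_gaussian_cons2 mFr (fun=> F0 _)).
rewrite (ge0_integral_std_gaussian_cons2 mF F0).
(* With the tails integrated out, [G] is a function on the plane, to which planar invariance
   applies. *)
pose G (z : R * R) := \int[std_gaussian R n]_s \int[std_gaussian R n]_t
   F (tuple_cons (z.1, s), tuple_cons (z.2, t)).
have mH : measurable_fun setT (fun u : ((R * R) * n.-tuple R) * n.-tuple R =>
    F (tuple_cons (u.1.1.1, u.1.2), tuple_cons (u.1.1.2, u.2))).
  apply: (measurableT_comp mF); apply: measurable_fun_pair.
    apply: measurable_cons.
      exact: (measurableT_comp measurable_fst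
        (measurableT_comp measurable_fst measurable_fst)).
    exact: (measurableT_comp measurable_snd measurable_fst).
  apply: measurable_cons; last exact: measurable_snd.
  exact: (measurableT_comp measurable_snd
    (measurableT_comp measurable_fst measurable_fst)).
have mH1 := measurable_fun_fubini_tonelli_F (m2 := std_gaussian R n) _ mH (fun=> F0 _).
have mG : measurable_fun setT G.
  apply: (measurable_fun_fubini_tonelli_F (m2 := std_gaussian R n) _ mH1).
  by move=> z; exact: integral_ge0.
rewrite -[RHS](integral_std_normal_rotation (F := G) ab b0 mG); last first.
  by move=> z; apply: integral_ge0 => s _; exact: integral_ge0.
apply: eq_integral => x _; apply: eq_integral => y _.
rewrite /G /=.
(* The heads are now rotated on both sides; the induction hypothesis rotates the tails. *)
rewrite -(IHn (fun z => F (tuple_cons (a * x + b * y, z.1)%R,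
                           tuple_cons (- b * x + a * y, z.2)%R))).
- apply: eq_integral => s _; apply: eq_integral => t _.
  by rewrite /rotation /= !tuple_comb_cons.
- apply: (measurableT_comp mF); apply: measurable_fun_pair.
    by apply: measurable_cons => //; exact: measurable_fst.
  by apply: measurable_cons => //; exact: measurable_snd.
- by move=> z; exact: F0.
Qed.

Lemma std_gaussian_rotation n (a b : R) (E : set (n.-tuple R * n.-tuple R)) :
  (a ^+ 2 + b ^+ 2 = 1)%R -> (b != 0)%R -> measurable E ->
  (std_gaussian R n \x std_gaussian R n) (rotation a b @^-1` E) =
  (std_gaussian R n \x std_gaussian R n) E.
Proof.
move=> ab b0 mE.
have mrE : measurable (rotation a b @^-1` E).
  by rewrite -[X in measurable X]setTI; exact: measurable_rotation.
have m1 : measurable_fun setT (fun z => (\1_E z)%:E : \bar R).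
  exact/measurable_EFinP/measurable_indic.
have m1r := measurableT_comp m1 (measurable_rotation a b).
transitivity (\int[std_gaussian R n \x std_gaussian R n]_z (\1_E (rotation a b z))%:E).
  by rewrite -[in LHS](setIT (_ @^-1` _)) -(integral_indic _ measurableT mrE).
transitivity (\int[std_gaussian R n \x std_gaussian R n]_z (\1_E z)%:E); last first.
  by rewrite integral_indic// setIT.
rewrite (fubini_tonelli1 _ m1); last by move=> z; rewrite lee_fin.
rewrite (fubini_tonelli1 _ m1r); last by move=> z; rewrite /= lee_fin.
apply: (integral_std_gaussian_rotation ab b0 m1).
by move=> z; rewrite lee_fin.
Qed.

End GaussianRotationTuple.

(** * Sign changes of a polynomial along a circle *)

Section PolynomialAlongCircle.
Variable R : realType.

(** The real and imaginary parts of (c + i s)^k, hence (cos (k t), sin (k t)) when c = cos t and s =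
    sin t. *)
Definition circle_pow (c s : R) (k : nat) : R * R :=
  iter k (fun z => (c * z.1 - s * z.2, c * z.2 + s * z.1)) (1, 0).

Lemma circle_powS c s k : circle_pow c s k.+1 =
  (c * (circle_pow c s k).1 - s * (circle_pow c s k).2,
   c * (circle_pow c s k).2 + s * (circle_pow c s k).1).
Proof. by []. Qed.

Lemma circle_pow_norm c s k : c ^+ 2 + s ^+ 2 = 1 ->
  (circle_pow c s k).1 ^+ 2 + (circle_pow c s k).2 ^+ 2 = 1.
Proof.
move=> cs; elim: k => [|k IHk]; first by rewrite /= expr1n expr0n addr0.
rewrite circle_powS /=; move: (circle_pow c s k) IHk => [a b] /= IHk.
transitivity ((c ^+ 2 + s ^+ 2) * (a ^+ 2 + b ^+ 2)); first by ring.
by rewrite cs IHk mulr1.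
Qed.

(** * Multiples of a small angle *)

Section SmallAngle.
Variables (delta s : R).
Hypotheses (delta01 : 0 < delta < 1) (s_gt0 : 0 < s).
Hypothesis sE : s ^+ 2 = 2 * delta - delta ^+ 2.
Local Notation cp := (circle_pow (1 - delta) s).

Let cs : (1 - delta) ^+ 2 + s ^+ 2 = 1. Proof. by rewrite sE; ring. Qed.

(** Keeps the point in the first quadrant. By induction, the step from k to k + 1 costs the cosine
    at most (2 k + 1) delta, and these odd multiples add up to a square. *)
Lemma circle_pow_bounds k : k%:R ^+ 2 * delta <= 1 ->
  [/\ 0 <= (cp k).2, (cp k).2 <= k%:R * s & 1 - k%:R ^+ 2 * delta <= (cp k).1].
Proof.
have /andP[d0 d1] := delta01.
elim: k => [|k IHk]; first by rewrite /= mul0r expr0n mul0r subr0 !lexx.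
rewrite circle_powS /= -natr1 => h.
have k0 : 0 <= k%:R :> R by [].
have [|b0 bs a1] := IHk; first by nra.
have := circle_pow_norm k cs.
move: (cp k) b0 bs a1 => [a b] /= b0 bs a1 ab1.
have a0 : 0 <= a by nra.
have ale1 : a <= 1 by nra.
have c0 : 0 <= 1 - delta by lra.
(* From b <= k s and s^2 <= 2 delta. *)
have h1 : s * b <= k%:R * (2 * delta).
  apply: (@le_trans _ _ (k%:R * s ^+ 2)).
    by rewrite expr2 mulrA [leRHS]mulrC ler_pM2l.
  by rewrite sE ler_wpM2l//; nra.
split.
- by rewrite addr_ge0// mulr_ge0// ltW.
- have : (1 - delta) * b <= b by rewrite ler_piMl//; lra.
  have : s * a <= s by rewrite ler_piMr// ltW.
  lra.
- have : delta * a <= delta by rewrite ler_piMr// ltW.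
  by move: a1 h1; rewrite !expr2; lra.
Qed.

(** The quotients are half-angle tangents. Clearing their positive denominators leaves s + s a -
    delta b > 0, which holds since a >= 0, b <= 1 and delta < s. *)
Lemma circle_pow_half_tangent_lt k :
  k%:R ^+ 2 * delta <= 1 -> k.+1%:R ^+ 2 * delta <= 1 ->
  (cp k).2 / (1 + (cp k).1) < (cp k.+1).2 / (1 + (cp k.+1).1).
Proof.
have /andP[d0 d1] := delta01.
move=> hk hk1.
have [b0 _ a0] := circle_pow_bounds hk.
have [_ _ a1] := circle_pow_bounds hk1.
have ap : 0 < 1 + (cp k).1 by lra.
have ap1 : 0 < 1 + (cp k.+1).1 by lra.
rewrite ltr_pdivrMr// mulrAC ltr_pdivlMr//.
move: ap1 ap b0 a0 (circle_pow_norm k cs) {a1}; rewrite circle_powS.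
move: (cp k) => [a b] /= ap1 ap b0 a0 n1.
(* Because s^2 - delta^2 = 2 delta (1 - delta) > 0. *)
have sd : delta < s.
  rewrite ltNge; apply/negP => sd.
  have : s ^+ 2 <= delta ^+ 2 by rewrite lerXn2r// nnegrE ltW.
  have : 0 < delta * (1 - delta) by rewrite mulr_gt0// subr_gt0.
  by rewrite sE mulrBr mulr1 -expr2; lra.
have b1 : b <= 1 by rewrite -(@expr_le1 _ 2)// -n1 lerDr sqr_ge0.
rewrite -subr_gt0.
have -> : ((1 - delta) * b + s * a) * (1 + a) - b * (1 + ((1 - delta) * a - s * b)) =
   s * (a ^+ 2 + b ^+ 2) + s * a - delta * b by ring.
rewrite n1.
have : delta * b <= delta by rewrite ler_piMr// ltW.
have : 0 <= s * a by apply: mulr_ge0; [exact: ltW|lra].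
lra.
Qed.

End SmallAngle.

(** Opposite weak signs at the ends give a root by the intermediate value theorem for [Q] or [- Q].
    Otherwise the convention at 0 caused the change, and an endpoint is a root; hence the closed
    interval. *)
Lemma sign_change_root (b : bool) (Q : {poly R}) (u v : R) : u <= v ->
  sign b Q.[u] <> sign b Q.[v] -> exists2 z, u <= z <= v & root Q z.
Proof.
move=> uv neq.
have [Qu|Qu] := leP Q.[u] 0; have [Qv|Qv] := leP 0 Q.[v].
- by apply: poly_ivt => //; rewrite Qu.
- move: Qu; rewrite le_eqVlt => /orP[/eqP Qu|Qu].
    by exists u; rewrite ?lexx// /root Qu.
  by case: neq; rewrite /sign !lt_eqF// !ltr0_sg.
- move: Qv; rewrite le_eqVlt => /orP[/eqP Qv|Qv].
    by exists v; rewrite ?lexx ?uv// /root -Qv.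
  by case: neq; rewrite /sign !gt_eqF// !gtr0_sg.
- have [|z zuv] := @poly_ivt _ (- Q) u v uv.
    by rewrite !hornerN oppr_le0 oppr_ge0 !ltW.
  by rewrite rootN => rz; exists z.
Qed.

(** Only every other interval is inspected: these are pairwise disjoint even as closed intervals, so
    no root is counted twice. *)
Lemma count_sign_changes (b : bool) (Q : {poly R}) (u : nat -> R) (m : nat) :
  (forall k, (k.+1 < m.*2)%N -> u k < u k.+1) ->
  (\sum_(j < m) (sign b Q.[u j.*2] != sign b Q.[u j.*2.+1]) <= (size Q).-1)%N.
Proof.
move=> uincr.
(* The zero polynomial has infinitely many roots, but its sign is constant. *)
have [->|Q0] := eqVneq Q 0.
  by rewrite big1// => j _; rewrite !horner0 eqxx.
pose change (j : 'I_m) := sign b Q.[u j.*2] != sign b Q.[u j.*2.+1].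
have j2 (j : 'I_m) : (j.*2.+1 < m.*2)%N by rewrite -doubleS leq_double ltn_ord.
(* [z j] is a root in the j-th interval if the sign changes there; 0 is a placeholder otherwise. *)
have /choice[z zP] (j : 'I_m) :
    exists z, change j -> u j.*2 <= z <= u j.*2.+1 /\ root Q z.
  have [cj|_] := boolP (change j); last by exists 0.
  have [||z zu rz] := @sign_change_root b Q (u j.*2) (u j.*2.+1).
  - exact/ltW/uincr/j2.
  - exact/eqP.
  - by exists z.
have umono i j : (i <= j)%N -> (j < m.*2)%N -> u i <= u j.
  move=> /subnK <-; elim: (j - i)%N => [|k IHk] //; rewrite addSn => kj.
  exact: le_trans (IHk (ltnW kj)) (ltW (uincr _ kj)).
have zlt (i j : 'I_m) : (i < j)%N -> change i -> change j -> z i < z j.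
  move=> ij /zP[/andP[_ zi] _] /zP[/andP[zj _] _].
  have i2j : (i.*2.+2 <= j.*2)%N by rewrite -doubleS leq_double.
  have jm : (j.*2 < m.*2)%N by rewrite ltn_double.
  apply: (le_lt_trans zi); apply: (lt_le_trans _ zj).
  apply: (lt_le_trans (uincr _ (leq_ltn_trans i2j jm))).
  exact: umono.
pose rs := [seq z j | j <- enum 'I_m & change j].
have : (size rs < size Q)%N.
  apply: max_poly_roots => //.
    by apply/allP => r /mapP[j]; rewrite mem_filter => /andP[/zP[_ rz] _] ->.
  rewrite map_inj_in_uniq; first exact/filter_uniq/enum_uniq.
  move=> i j.
  rewrite !mem_filter => /andP[ci _] /andP[cj _] zij.
  apply/val_inj; have [ij|ji|//] := ltngtP (i : nat) j.
    by have := zlt _ _ ij ci cj; rewrite zij ltxx.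
  by have := zlt _ _ ji cj ci; rewrite zij ltxx.
rewrite size_map size_filter => hs.
rewrite (_ : \sum_(j < m) _ = count change (enum 'I_m))%N; last first.
  rewrite -sum1_count [RHS]big_mkcond [RHS]big_enum/=.
  by apply: eq_bigr => j _; rewrite -/(change j); case: (change j).
by case: (size Q) hs.
Qed.

Lemma size_mul_leS (p q : {poly R}) i j :
  (size p <= i.+1)%N -> (size q <= j.+1)%N -> (size (p * q)%R <= (i + j).+1)%N.
Proof.
move=> hp hq; apply: leq_trans (size_polyMleq _ _) _.
have := leq_add hp hq; rewrite addSn addnS.
by case: (_ + _)%N.
Qed.

Lemma size_exp_leS (p : {poly R}) i k :
  (size p <= i.+1)%N -> (size (p ^+ k)%R <= (i * k).+1)%N.
Proof.
move=> hp; elim: k => [|k IHk]; first by rewrite expr0 size_poly1.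
by rewrite exprS mulnS; exact: size_mul_leS.
Qed.

(* The rational parametrization a = (1 - u^2) / (1 + u^2), b = 2 u / (1 + u^2)
   of the circle, u being the tangent of the half-angle. *)
Lemma polynomial_along_circle n d (P : {mpoly R[n]}) (x y : 'I_n -> R) :
  (msize P <= d.+1)%N ->
  exists2 Q : {poly R}, (size Q <= (2 * d).+1)%N &
  forall a b, a ^+ 2 + b ^+ 2 = 1 -> 0 < 1 + a ->
  exists2 r, 0 < r & Q.[b / (1 + a)] = r * P.@[fun i => a * x i + b * y i].
Proof.
move=> sP.
(* At u, [q i] takes the value (1 + u^2) (a x_i + b y_i). *)
pose q i : {poly R} := (1 - 'X^2) * (x i)%:P + 'X * (2 * y i)%:P.
(* The powers of 1 + X^2 pad each monomial to degree d, so that all share the factor (1 + u^2)^d. *)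
pose Q := \sum_(m <- msupp P)
  ((P@_m)%:P * (1 + 'X^2) ^+ (d - mdeg m)) * \prod_(i < n) q i ^+ m i.
have s2 : (size (1 + 'X^2 : {poly R})%R <= 3)%N.
  by rewrite (leq_trans (size_polyD _ _))// geq_max size_poly1 size_polyXn.
have s2' : (size (1 - 'X^2 : {poly R})%R <= 3)%N.
  by rewrite (leq_trans (size_polyD _ _))// geq_max size_poly1 size_polyN size_polyXn.
have sq i : (size (q i) <= 3)%N.
  rewrite (leq_trans (size_polyD _ _))// geq_max; apply/andP; split.
    by rewrite -[3%N]/((2 + 0).+1); apply: size_mul_leS; rewrite ?size_polyC_leq1.
  rewrite -[3%N]/((2 + 0).+1); apply: size_mul_leS; rewrite ?size_polyC_leq1//.
  by rewrite size_polyX.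
have mdegP m : m \in msupp P -> (mdeg m <= d)%N.
  by move=> mP; rewrite -ltnS (leq_trans (msize_mdeg_lt mP)).
exists Q.
  apply: (leq_trans (size_sum _ _ _)); apply/bigmax_leqP_seq => m mP _.
  rewrite -[(2 * d)%N](subnK (_ : 2 * mdeg m <= 2 * d)%N); last first.
    by rewrite leq_mul2l mdegP.
  apply: size_mul_leS.
    rewrite -[X in (_ <= X.+1)%N]add0n -mulnBr.
    by apply: size_mul_leS; [exact: size_polyC_leq1|exact: size_exp_leS].
  rewrite mdegE big_distrr/=.
  elim/big_ind2 : _ => [|p i r j hp hr|i _]; first by rewrite size_poly1.
    exact: size_mul_leS.
  exact: size_exp_leS.
move=> a b ab1 a0.
set u := b / (1 + a).
have a0' : 1 + a != 0 by rewrite gt_eqF.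
have b2 : b ^+ 2 = 1 - a ^+ 2 by rewrite -ab1; ring.
have uE : 1 + u ^+ 2 = 2 / (1 + a).
  by rewrite /u expr_div_n b2; field.
have aE : 1 - u ^+ 2 = (2 / (1 + a)) * a.
  by rewrite /u expr_div_n b2; field.
have bE : 2 * u = (2 / (1 + a)) * b by rewrite /u; field.
have r0 : 0 < 2 / (1 + a) by rewrite divr_gt0.
exists ((2 / (1 + a)) ^+ d); first exact: exprn_gt0.
rewrite /Q horner_sum mevalE mulr_sumr; apply: eq_big_seq => m mP.
have eu : (1 + 'X^2).[u] = 2 / (1 + a) by rewrite -uE !hornerE.
have eq i : (q i).[u] = 2 / (1 + a) * (a * x i + b * y i).
  rewrite /q hornerD !hornerM !hornerC hornerX (_ : (1 - 'X^2).[u] = 1 - u ^+ 2).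
    by rewrite aE mulrDr !mulrA -bE; ring.
  by rewrite !hornerE.
have eprod : \prod_(i < n) (q i ^+ m i).[u] =
    (2 / (1 + a)) ^+ mdeg m * \prod_(i < n) (a * x i + b * y i) ^+ m i.
  rewrite mdegE -prodrXr -big_split/=; apply: eq_bigr => i _.
  by rewrite horner_exp eq exprMn.
rewrite 2!hornerM hornerC horner_exp horner_prod eu eprod.
rewrite -[in RHS](subnK (mdegP _ mP)) exprD; ring.
Qed.

End PolynomialAlongCircle.

(** * The noise sensitivity bound *)

Section NoiseSensitivityBound.
Variable R : realType.

Lemma rotation_comp n (c s a b : R) (z : n.-tuple R * n.-tuple R) :
  rotation c s (rotation a b z) = rotation (c * a - s * b) (c * b + s * a) z.
Proof.
by congr pair; apply: eq_from_tnth => i; rewrite !tnth_mktuple; ring.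
Qed.

(** The k-th rotation is the k-fold iterate of a single one, so only s itself must be nonzero, not
    every sin (k t). *)
Lemma std_gaussian_circle_pow n (c s : R) k (E : set (n.-tuple R * n.-tuple R)) :
  c ^+ 2 + s ^+ 2 = 1 -> s != 0 -> measurable E ->
  (std_gaussian R n \x std_gaussian R n)%E
    (rotation (circle_pow c s k).1 (circle_pow c s k).2 @^-1` E) =
  (std_gaussian R n \x std_gaussian R n)%E E.
Proof.
move=> cs s0; elim: k E => [|k IHk] E mE.
  have -> : rotation (circle_pow c s 0).1 (circle_pow c s 0).2 =
      @id (n.-tuple R * n.-tuple R).
    apply/funext => -[x y]; congr pair; apply: eq_from_tnth => i;
      by rewrite tnth_mktuple /=; ring.
  by rewrite preimage_id.
have -> : rotation (circle_pow c s k.+1).1 (circle_pow c s k.+1).2 =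
    rotation c s \o rotation (n := n) (circle_pow c s k).1 (circle_pow c s k).2.
  by apply/funext => z; rewrite [RHS]rotation_comp.
rewrite comp_preimage IHk; first exact: std_gaussian_rotation.
by rewrite -[X in measurable X]setTI; exact: measurable_rotation.
Qed.

Lemma measurable_sign b : measurable_fun setT (@sign R b).
Proof.
apply: measurable_fun_ifT => //; first exact: measurable_fun_eqr.
apply: measurable_fun_ifT => //; first exact: measurable_fun_eqr.
by apply: measurable_fun_ifT => //; exact: measurable_fun_ltr.
Qed.

Lemma measurable_peval n (P : {mpoly R[n]}) : measurable_fun setT (peval P).
Proof.
rewrite (_ : peval P = fun x => \sum_(m <- msupp P)
  P@_m * \prod_(i <- index_enum 'I_n) tnth x i ^+ m i); last first.
  by apply/funext => x; rewrite /peval mevalE.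
apply: measurable_sum => m; apply: measurable_funM => //.
apply: measurable_prod => i _.
by apply: measurable_funX; exact: measurable_tnth.
Qed.

Lemma sign_pmul b (r x : R) : 0 < r -> sign b (r * x) = sign b x.
Proof.
by move=> r0; rewrite /sign mulf_eq0 gt_eqF//= sgrM gtr0_sg// mul1r.
Qed.

Variables (b : bool) (n d : nat) (P : {mpoly R[n]}) (delta : R).
Hypotheses (degP : pdegree P = d) (delta01 : 0 < delta < 1).

Let s := Num.sqrt (2 * delta - delta ^+ 2).
Let f (x : n.-tuple R) := sign b (peval P x).
Let mu := (std_gaussian R n \x std_gaussian R n)%E.
Let E := [set xy : n.-tuple R * n.-tuple R | f xy.1 <> f (noisy delta xy.1 xy.2)].
Let cp := circle_pow (1 - delta) s.

Let sE : s ^+ 2 = 2 * delta - delta ^+ 2.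
Proof. by rewrite sqr_sqrtr//; case/andP: delta01 => d0 d1; nra. Qed.

Let s_gt0 : 0 < s.
Proof. by rewrite sqrtr_gt0; case/andP: delta01 => d0 d1; nra. Qed.

Let cs : (1 - delta) ^+ 2 + s ^+ 2 = 1.
Proof. by rewrite sE; ring. Qed.

Let measurable_E : measurable E.
Proof.
have mf : measurable_fun setT f.
  exact: (measurableT_comp (measurable_sign b) (measurable_peval P)).
have mg : measurable_fun setT (fun xy : n.-tuple R * n.-tuple R =>
    f xy.1 == f (noisy delta xy.1 xy.2)).
  apply: measurable_fun_eqr; first exact: (measurableT_comp mf measurable_fst).
  exact: (measurableT_comp mf (measurable_tuple_comb (1 - delta) s)).
rewrite (_ : E = setT `&`
    (fun xy => f xy.1 == f (noisy delta xy.1 xy.2)) @^-1` [set false]).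
  exact: mg.
rewrite setTI; apply/seteqP; split=> [xy /= /eqP/negbTE//|xy /= /negbT/eqP//].
Qed.

Let GNS_fin_num : GNS delta f \is a fin_num.
Proof.
have := measurable_E; rewrite /GNS -/f -/E => mE.
rewrite ge0_fin_numE; last exact: measure_ge0.
apply: le_lt_trans (ltry 1).
exact: (probability_le1 (std_gaussian R n \x std_gaussian R n)%E mE).
Qed.

Let E_ k := rotation (cp k).1 (cp k).2 @^-1` E.

(** By the angle-addition formulas, [noisy] applied to the k-th rotated pair yields the next point
    on the circle. *)
Let E_P k x y : E_ k (x, y) <->
  f (tuple_comb (cp k).1 (cp k).2 x y) <> f (tuple_comb (cp k.+1).1 (cp k.+1).2 x y).
Proof.
rewrite /E_ /E /= (_ : noisy _ _ _ = tuple_comb (cp k.+1).1 (cp k.+1).2 x y)//.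
by apply: eq_from_tnth => i; rewrite tnth_mktuple /= !tnth_mktuple /= /cp -/s; ring.
Qed.

(** At the points used, [P] is a positive factor times [Q] at increasing half-angle tangents, so
    sign changes of f are sign changes of [Q]. *)
Lemma sum_changes_le m (z : n.-tuple R * n.-tuple R) :
  (m.*2.-1)%:R ^+ 2 * delta <= 1 ->
  \sum_(j < m) \1_(E_ j.*2) z <= (2 * d)%:R :> R.
Proof.
(* The largest index in use is 2 m - 1, so [hm] covers all of them. *)
move=> hm; have hk k : (k < m.*2)%N -> k%:R ^+ 2 * delta <= 1.
  move=> km; apply: le_trans hm; case/andP: delta01 => d0 _.
  rewrite ler_pM2r// lerXn2r ?nnegrE// ler_nat.
  by rewrite -ltnS prednK// (leq_ltn_trans _ km).
case: z => x y.
have [|Q sQ QE] := @polynomial_along_circle R n d P (tnth x) (tnth y).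
  by rewrite -degP /pdegree; exact: leqSpred.
pose u k := (cp k).2 / (1 + (cp k).1).
have fE k : (k < m.*2)%N -> f (tuple_comb (cp k).1 (cp k).2 x y) = sign b Q.[u k].
  move=> km; have [_ _ a0] := circle_pow_bounds delta01 s_gt0 sE (hk k km).
  have [||r r0 ->] := QE (cp k).1 (cp k).2.
  - exact: circle_pow_norm.
  - by have := hk k km; rewrite -/cp in a0; lra.
  rewrite sign_pmul//; congr sign; apply: meval_eq => i.
  by rewrite tnth_mktuple.
have uincr k : (k.+1 < m.*2)%N -> u k < u k.+1.
  move=> km; apply: circle_pow_half_tangent_lt => //; last exact: hk.
  exact/hk/ltnW.
apply: (@le_trans _ _ (\sum_(j < m) (sign b Q.[u j.*2] != sign b Q.[u j.*2.+1]))%:R).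
  rewrite natr_sum ler_sum// => j _; rewrite indicE.
  have j2 : (j.*2.+1 < m.*2)%N by rewrite -doubleS leq_double ltn_ord.
  rewrite -(fE _ (ltnW j2)) -(fE _ j2) ler_nat.
  case: (boolP ((x, y) \in _)) => //; rewrite inE => /E_P/eqP.
  by move=> ->.
rewrite ler_nat (leq_trans (count_sign_changes b Q uincr))//.
by case: (size Q) sQ.
Qed.

(** All the events [E_ k] have probability [GNS delta f]; the sum of m of these is the expected
    number of changes, bounded pointwise by 2 d. *)
Lemma GNS_multiple_le m : (m.*2.-1)%:R ^+ 2 * delta <= 1 ->
  (m%:R%:E * GNS delta f <= (2 * d)%:R%:E)%E.
Proof.
move=> hm.
have mE_ k : measurable (E_ k).
  by rewrite -[X in measurable X]setTI; exact: measurable_rotation.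
have -> : (m%:R%:E * GNS delta f = \sum_(j < m) mu (E_ j.*2))%E.
  rewrite (eq_bigr (fun=> GNS delta f)) => [|j _]; last first.
    by apply: std_gaussian_circle_pow => //; rewrite gt_eqF.
  by rewrite -(fineK GNS_fin_num) sumEFin sumr_const card_ord -EFinM mulr_natl.
have -> : (\sum_(j < m) mu (E_ j.*2) =
    \int[mu]_z (\sum_(j < m) (\1_(E_ j.*2) z)%:E))%E.
  rewrite ge0_integral_sum//.
  - by apply: eq_bigr => j _; rewrite integral_indic// setIT.
  - by move=> j; exact/measurable_EFinP/measurable_indic.
apply: (@le_trans _ _ (\int[mu]_z (cst (2 * d)%:R%:E z)))%E.
  apply: ge0_le_integral => //.
  - by move=> z _; apply: sume_ge0 => j _; rewrite lee_fin.
  - by apply: emeasurable_sum => j; exact/measurable_EFinP/measurable_indic.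
  - by move=> z _; rewrite sumEFin lee_fin; exact: sum_changes_le.
rewrite integral_cst// -[leRHS]mule1 lee_wpmul2l ?lee_fin//.
exact: (probability_le1 (std_gaussian R n \x std_gaussian R n)%E measurableT).
Qed.

Lemma GNS_sign_le : (GNS delta f <= (8 * d%:R * Num.sqrt delta)%:E)%E.
Proof.
have [d0 d1] := andP delta01.
set r := Num.sqrt delta.
have r0 : 0 < r by rewrite sqrtr_gt0.
have r2 : r ^+ 2 = delta by rewrite sqr_sqrtr// ltW.
have r1 : r < 1 by rewrite -(@expr_lt1 _ 2)// ?ltW// r2.
have ri : 1 < r^-1 by rewrite invf_gt1.
have rr : r^-1 * r = 1 by rewrite mulVf// gt_eqF.
(* The largest m with 2 m - 1 <= 1 / sqrt delta; it is at least 1 because delta < 1. *)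
pose m := Num.truncn ((1 + r^-1) / 2).
have mle : m%:R <= (1 + r^-1) / 2 by rewrite truncn_le; lra.
have mgt : (1 + r^-1) / 2 < m.+1%:R by exact: truncnS_gt.
have m1 : (1 <= m)%N by rewrite truncn_gt0; lra.
have hm : (m.*2.-1)%:R ^+ 2 * delta <= 1.
  rewrite -r2 -exprMn expr_le1 ?mulr_ge0 ?(ltW r0)//.
  rewrite -[leRHS]rr ler_pM2r// -subn1 natrB ?double_gt0// -mul2n natrM.
  lra.
have := GNS_multiple_le hm.
rewrite -(fineK GNS_fin_num); set g := fine _.
rewrite -EFinM !lee_fin natrM => h.
have m1' : 1 <= m%:R :> R by rewrite ler1n.
have g0 : 0 <= g by exact: fine_ge0.
rewrite -[m.+1%:R]natr1 in mgt.
(* By maximality of m, 1 / r < 2 m + 1, which is at most 4 m. *)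
have h2 : r^-1 * g <= 4 * (m%:R * g).
  by rewrite mulrA ler_wpM2r//; lra.
have : r^-1 * g <= 8 * d%:R by lra.
by rewrite -ler_pdivlMl ?invr_gt0// invrK mulrC.
Qed.

End NoiseSensitivityBound.

Theorem mainTheorem2 (R : realType) :
  exists C : R, 0 < C /\
  forall (b : bool) (n d : nat) (P : {mpoly R[n]}),
    pdegree P = d ->
    multilinear P \/ ellipsoidal P ->
    forall delta : R, 0 < delta < 1 ->
    (GNS delta (fun x : n.-tuple R => sign b (peval P x)) <=
       (2 `^ (C * d%:R) * delta `^ ((2 * d + 1)%:R)^-1)%:E)%E.
Proof.
(* With C = 4 the first factor is 16^d, which dominates 8 d when d >= 1. *)
exists 4; split=> // b n d P degP _ delta delta01.
apply: le_trans (GNS_sign_le b degP delta01) _; rewrite lee_fin.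
(* For d = 0 the bound 8 d sqrt delta is already 0. *)
case: d {degP} => [|d]; first by rewrite mulr0 mul0r mulr_ge0// powR_ge0.
have [d0 d1] := andP delta01.
rewrite ler_pM//.
- rewrite -[4 * _]natrM powR_mulrn// -[8 * _]natrM -natrX ler_nat expnM.
  elim: d => [//|d IHd]; rewrite expnS.
  by apply: leq_trans (leq_mul (leqnn 16) IHd); rewrite mulnCA leq_mul2l; lia.
(* As delta < 1, a smaller exponent gives a larger power, and 1 / (2 d + 1) <= 1 / 2 for positive
   degree. *)
- rewrite -powR12_sqrt; last exact: ltW.
  apply: ger_powR; first by rewrite d0 ltW.
  by rewrite lef_pV2 ?posrE ?ltr0n ?addn1// ler_nat.
Qed.
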